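(* Suppose that $(G,X)$ is a self-similar action. Then the Zappa–Szép product $S:=X^*\bowtie G$ has the following properties: (i) $S$ is admissible with $\beta_c=1$. (ii) The action $\alpha$ is faithful (respectively almost free) if and only if $G\curvearrowright X^*$ is faithful (respectively almost free). (iii) $S$ has finite propagation if and only if for all $g^{(1)},g^{(2)}\in G$ there exists a family $(h_w)_{w\in X^*}\subset G$ such that $\{h_{g^{(i)}(w)}^{-1}\,g^{(i)}|_w\,h_w: w\in X^*\}$ is finite for $i=1,2$. In particular, $S$ has finite propagation if $(G,X)$ is finite state, i.e. if $\{g|_w: w\in X^*\}$ is finite for all $g\in G$.
   Context: All semigroups are countable discrete monoids; $\mathbb{N}^\times$ is the multiplicative monoid of positive integers. **Self-similar actions.** Let $X$ be a finite alphabet, $X^n$ the set of words of length $n$, and $X^*=\bigcup_{n\ge0}X^n$ the monoid of words under concatenation, with identity the empty word $\varnothing$. A self-similar action $(G,X)$ is an action of a (countable) group $G$ on $X^*$, preserving each $X^n$, such that for every $g\in G$ and $x\in X$ there is a uniquely determined element $g|_x\in G$ with $g(xw)=g(x)\,g|_x(w)$ for all $w\in X^*$. Restrictions are extended to words by $g|_\varnothing=g$, $g|_{xw}=(g|_x)|_w$. $X^*\bowtie G$ is the set $X^*\times G$ with multiplication $(v,g)(w,h)=(v\,g(w),\,g|_w\,h)$; it is a right LCM semigroup. **Right LCM semigroups.** A monoid $S$ is right LCM if it is left cancellative and for all $s,t\in S$ the set $sS\cap tS$ is empty or of the form $rS$; such $r$ is a right LCM of $s,t$. $S^*$ is the group of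 invertible elements. $S_c=\{a\in S: aS\cap sS\ne\emptyset\ \forall s\in S\}$. $S_{ci}$ is the set of $s\in S\setminus S_c$ such that every factorisation $s=ta$ with $a\in S_c$ forces $a\in S^*$; $S_{ci}^1=S_{ci}\cup\{1\}$. $s\sim t$ means $sa=tb$ for some $a,b\in S_c$; $[s]$ is the class of $s$. A transversal for $A/_\sim$, $A\subset S$, is a subset of $A$ that is a minimal complete set of representatives. A finite $F\subset S$ is a foundation set if every $s\in S$ satisfies $sS\cap fS\neq\emptyset$ for some $f\in F$; it is accurate if $fS\cap f'S=\emptyset$ for distinct $f,f'\in F$. **Admissibility.** For a submonoid $M$ of $\mathbb{N}^\times$, $\mathrm{Irr}(M)$ is the set of $m\in M$, $m\ne1$, such that $m=kl$ with $k,l\in M$ implies $k=1$ or $l=1$. $S$ is admissible if: (A1) $S=S_{ci}^1S_c$; (A2) any right LCM of two elements of $S_{ci}$ belongs to $S_{ci}$; (A3) there is a nontrivial monoid homomorphism $N\colon S\to\mathbb{N}^\times$ (a generalised scale) such that (a) $|N^{-1}(n)/_\sim|=n$ for all $n\in N(S)$ and (b) for each $n\in N(S)$ every transversal of $N^{-1}(n)/_\sim$ is an accurate foundation set for $S$; (A4) $N(S)$ is the free abelian monoid in $\mathrm{Irr}(N(S))$. The critical inverse temperature $\beta_c\in\mathbb{R}\cup\{\infty\}$ is the smallest value such that $\zeta_S(\beta)=\sum_{n\in N(S)}n^{-(\beta-1)}$ is finite for all real $\beta>\beta_c$. Here the generalised scale on $S=X^*\bowtie G$ is $N(w,g)=|X|^{\ell(w)}$,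 with $\ell(w)$ the word length. **Actions.** $\alpha\colon S_c\curvearrowright S/_\sim$ is given by $\alpha_a([s])=[as]$. An action $\gamma\colon T\curvearrowright Y$ of a monoid is faithful if for all $s\ne t$ in $T$ there is $y\in Y$ with $\gamma_s(y)\neq\gamma_t(y)$, and almost free if $\{y\in Y:\gamma_s(y)=\gamma_t(y)\}$ is finite for all $s\neq t$ in $T$. **Finite propagation.** For an admissible $S$ and a transversal $\mathcal{T}$ for $S/_\sim$ with $\mathcal{T}\subset S_{ci}^1$, each $s\in S$ is uniquely $s=i(s)c(s)$ with $i(s)\in\mathcal{T}$, $c(s)\in S_c$; put $C_a=\{c(af):f\in\mathcal{T}\}$. $S$ has finite propagation if for every $(a,b)\in S_c\times S_c$ there is such a $\mathcal{T}$ for which $C_a$ and $C_b$ are finite.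
   Formalization: The alphabet X is assumed to have at least two letters; for |X| ≤ 1 the semigroup S has no nontrivial generalised scale, so S is not admissible and (i) fails. *)

(* Defs.v *)
From HB Require Import structures.
Set Warnings "-notation-overridden,-ambiguous-paths,-notation-incompatible-prefix".
From mathcomp Require Import all_boot all_order all_algebra.
From mathcomp Require Import all_classical all_reals all_analysis.

Set Implicit Arguments.
Unset Strict Implicit.
Unset Printing Implicit Defensive.

Import Order.TTheory GRing.Theory Num.Theory.

Local Open Scope classical_set_scope.
Local Open Scope group_scope.

Section RightLCM.
Variable S : monoidType.
Implicit Types (s t a b c r : S) (A T F C : set S).

Definition rideal s : set S := range (fun x => s * x).

Definition is_right_lcm r s t : Prop := rideal s `&` rideal t = rideal r.

Definition left_cancellative : Prop :=
  forall s t u : S, s * t = s * u -> t = u.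

Definition right_LCM : Prop :=
  left_cancellative /\
  forall s t, rideal s `&` rideal t = set0 \/ exists r, is_right_lcm r s t.

Definition invertible : set S := [set a | exists b, a * b = 1 /\ b * a = 1].

Definition Sc : set S := [set a | forall s, rideal a `&` rideal s !=set0].

Definition Sci : set S :=
  [set s | ~ Sc s /\ forall t a, Sc a -> s = t * a -> invertible a].

Definition Sci1 : set S := Sci `|` [set 1].

Definition sim s t : Prop := exists a b, [/\ Sc a, Sc b & s * a = t * b].

Definition cls s : set S := [set t | sim s t].

(* For A = setT this is S/~; for general A it is the set of all [s], s in A,
   which is in bijection with A/~. *)
Definition quot A : set (set S) := cls @` A.

Definition complete_reps A T : Prop :=
  T `<=` A /\ forall s, A s -> exists2 t, T t & sim s t.

Definition transversal A T : Prop :=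
  complete_reps A T /\ forall T', T' `<=` T -> complete_reps A T' -> T' = T.

Definition foundation_set F : Prop :=
  finite_set F /\ forall s, exists2 f, F f & rideal s `&` rideal f !=set0.

Definition accurate F : Prop :=
  forall f f', F f -> F f' -> f <> f' -> rideal f `&` rideal f' = set0.

End RightLCM.

(* Submonoids of the multiplicative monoid of positive integers are sets of
   natural numbers. *)
Definition Irr (M : set nat) : set nat :=
  [set m | [/\ M m, m <> 1%N &
    forall k l, M k -> M l -> m = (k * l)%N -> k = 1%N \/ l = 1%N]].

(* The elements of the free abelian monoid in Irr(M) are the finite multisets
   of elements of Irr(M), i.e. sequences up to perm_eq. *)
Definition free_on_Irr (M : set nat) : Prop :=
  (forall m, M m -> exists2 e : seq nat,
     {in e, forall p, Irr M p} & m = (\prod_(p <- e) p)%N) /\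
  (forall e e' : seq nat,
     {in e, forall p, Irr M p} -> {in e', forall p, Irr M p} ->
     (\prod_(p <- e) p = \prod_(p <- e') p)%N -> perm_eq e e').

Section Admissible.
Variable S : monoidType.
Implicit Type N : S -> nat.

Definition A1 : Prop :=
  forall s : S, exists t a, [/\ Sci1 t, Sc a & s = t * a].

Definition A2 : Prop :=
  forall s t r : S, Sci s -> Sci t -> is_right_lcm r s t -> Sci r.

Definition nontrivial_hom N : Prop :=
  [/\ forall s, (0 < N s)%N,
      N 1 = 1%N,
      forall s t, N (s * t) = (N s * N t)%N &
      exists s, N s <> 1%N].

Definition generalised_scale N : Prop :=
  [/\ nontrivial_hom N,
      forall n, range N n -> (quot (N @^-1` [set n]) #= `I_n)%card &
      forall n, range N n -> forall T, transversal (N @^-1` [set n]) T ->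
        foundation_set T /\ accurate T].

Definition admissible_with N : Prop :=
  [/\ right_LCM S, A1, A2, generalised_scale N & free_on_Irr (range N)].

Definition admissible : Prop := exists N, admissible_with N.

Definition zeta (R : realType) N (beta : R) : \bar R :=
  (\esum_(n in range N) (n%:R `^ (- (beta - 1)))%:E)%R.

Definition zeta_finite_above (R : realType) N (b : \bar R) : Prop :=
  forall beta : R, (b < beta%:E)%E -> (zeta N beta < +oo)%E.

Definition critical_inverse_temperature (R : realType) N (b : \bar R) : Prop :=
  [/\ b <> -oo%E, zeta_finite_above N b &
      forall b' : \bar R, b' <> -oo%E -> zeta_finite_above N b' -> (b <= b')%E].

End Admissible.

(* An action of D on Y, where D and Y are subsets of ambient types. *)
Section Actions.
Variables (M E : Type) (D : set M) (Y : set E) (act : M -> E -> E).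

Definition faithful_action : Prop :=
  forall s t, D s -> D t -> s <> t -> exists2 y, Y y & act s y <> act t y.

Definition almost_free_action : Prop :=
  forall s t, D s -> D t -> s <> t ->
    finite_set [set y | Y y /\ act s y = act t y].

End Actions.

Section Alpha.
Variable S : monoidType.
Implicit Types (s t a b c : S) (T C : set S).

(* Defined on arbitrary subsets of S; on S/~ it is [s] |-> [as], see
   alpha_cls. *)
Definition alpha a C : set S := [set t | exists2 s, C s & sim (a * s) t].

Lemma Sc1 : Sc (1 : S).
Proof. by move=> s; exists s; split; [exists s|exists 1]; rewrite ?mul1g ?mulg1. Qed.

Lemma sim_refl s : sim s s.
Proof. by exists 1, 1; split=> //; exact: Sc1. Qed.

Lemma ScM : left_cancellative S -> forall a b, Sc a -> Sc b -> Sc (a * b).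
Proof.
move=> lc a b ca cb s; have [_ [[x _ <-] [y _ e]]] := ca s.
have [_ [[u _ <-] [v _ e']]] := cb x.
exists (a * (b * u)); split; first by exists u => //; rewrite mulgA.
by exists (y * v) => //; rewrite -e' mulgA e mulgA.
Qed.

Lemma Sc_ore : right_LCM S -> forall a b, Sc a -> Sc b ->
  exists x y, [/\ Sc x, Sc y & a * x = b * y].
Proof.
move=> [lc lcm] a b ca cb.
have [e|[r e]] := lcm a b.
  by have := ca b; rewrite e => -[? []].
have : rideal r r by exists 1; rewrite ?mulg1.
rewrite -e => -[[x _ ex] [y _ ey]].
have cr : Sc r.
  move=> s; have [_ [[u _ <-] [v _ ev]]] := ca s.
  have [_ [[p _ <-] [q _ eq_]]] := cb (a * u).
  exists (b * p); split; last by exists (v * q); rewrite // mulgA ev.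
  by rewrite -e; split; [exists (u * q); rewrite // mulgA | exists p].
have aux c z : c * z = r -> Sc z.
  move=> ez s; have [_ [[u _ <-] [v _ ev]]] := cr (c * s).
  exists (z * u); split; first by exists u.
  by exists v => //; apply: (lc c); rewrite !mulgA ez.
by exists x, y; split; [exact: aux ex|exact: aux ey|rewrite ex ey].
Qed.

Lemma sim_sym s t : sim s t -> sim t s.
Proof. by move=> [a [b [? ? ?]]]; exists b, a. Qed.

Lemma sim_trans : right_LCM S -> forall s t u, sim s t -> sim t u -> sim s u.
Proof.
move=> lcm s t u [a [b [ca cb e]]] [c [d [cc cd e']]].
have [x [y [cx cy exy]]] := Sc_ore lcm cb cc.
exists (a * x), (d * y); split; [exact: ScM lcm.1 _ _ _ _|exact: ScM lcm.1 _ _ _ _|].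
by rewrite mulgA e -mulgA exy mulgA e' mulgA.
Qed.

Lemma alpha_cls : right_LCM S -> forall a s, alpha a (cls s) = cls (a * s).
Proof.
move=> lcm a s; apply/seteqP; split=> t.
  move=> [u [b [c [cb cc e]]] sut]; apply: sim_trans lcm _ _ _ _ sut.
  by exists b, c; rewrite -!mulgA e.
by move=> st; exists s => //; exact: sim_refl.
Qed.

(* T stands for a transversal of S/~ contained in Sci1: every s is then
   uniquely i(s) c(s) with i(s) in T and c(s) in Sc, and the set below is
   {c(af) : f in T}. *)
Definition C_set T a : set S :=
  [set c | Sc c /\ exists f i, [/\ T f, T i & a * f = i * c]].

Definition finite_propagation : Prop :=
  forall a b, Sc a -> Sc b ->
    exists T, [/\ transversal [set: S] T, T `<=` @Sci1 S,
                  finite_set (C_set T a) & finite_set (C_set T b)].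

End Alpha.

(* The restriction g|_x is part of the data. Its two cocycle identities hold
   automatically when g|_x is the only element with
   g(xw) = g(x) g|_x(w) for all w (see self_similar_of_unique); that uniqueness
   forces the action to be faithful, whereas in general the identities are
   exactly what the Zappa-Szep product requires. *)
Record self_similar (G : groupType) (X : finType) := SelfSimilar {
  act : G -> seq X -> seq X;
  rst : G -> X -> G;
  act1 : forall w, act 1 w = w;
  actM : forall g h w, act (g * h) w = act g (act h w);
  size_act : forall g w, size (act g w) = size w;
  act_cons : forall g x w, act g (x :: w) = act g [:: x] ++ act (rst g x) w;
  rst1 : forall x, rst 1 x = 1;
  rstM : forall g h x,
    rst (g * h) x = foldl rst g (act h [:: x]) * rst h x
}.

Section SelfSimilar.
Variables (G : groupType) (X : finType).

Lemma self_similar_of_unique (a : G -> seq X -> seq X) :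
  (forall w, a 1 w = w) -> (forall g h w, a (g * h) w = a g (a h w)) ->
  (forall g w, size (a g w) = size w) ->
  (forall g x, exists! h, forall w, a g (x :: w) = a g [:: x] ++ a h w) ->
  exists A : self_similar G X, act A = a.
Proof.
move=> a1 aM sz uq; pose r g x := xget 1
  [set h | forall w, a g (x :: w) = a g [:: x] ++ a h w].
have rE g x w : a g (x :: w) = a g [:: x] ++ a (r g x) w.
  have [h [hP _]] := uq g x; move: w.
  exact: (xgetPex 1 (ex_intro (fun k => forall w, _ = _ ++ a k w) h hP)).
have rU g x h : (forall w, a g (x :: w) = a g [:: x] ++ a h w) -> r g x = h.
  by have [k [_ kP]] := uq g x => hP; rewrite -(kP _ hP) -(kP _ (rE g x)).
have r1 x : r 1 x = 1 by apply: rU => w; rewrite !a1.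
have rM g h x : r (g * h) x = foldl r g (a h [:: x]) * r h x.
  apply: rU => w; rewrite !aM rE.
  by case: (a h [:: x]) (sz h [:: x]) => [|y []]//= _; rewrite rE.
by exists (@SelfSimilar G X a r a1 aM sz rE r1 rM).
Qed.

Variable A : self_similar G X.

Definition rstw (g : G) (w : seq X) : G := foldl (rst A) g w.

Definition finite_state : Prop := forall g, finite_set (range (rstw g)).

Lemma rstw_cat g v w : rstw g (v ++ w) = rstw (rstw g v) w.
Proof. exact: foldl_cat. Qed.

Lemma act_nil g : act A g [::] = [::].
Proof. exact/size0nil/size_act. Qed.

Lemma act_cat g v w : act A g (v ++ w) = act A g v ++ act A (rstw g v) w.
Proof.
elim: v g => [|x v IH] g /=; first by rewrite act_nil.
by rewrite act_cons IH [act A g (x :: v)]act_cons catA.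
Qed.

Lemma rstw1 w : rstw 1 w = 1.
Proof. by elim: w => //= x w; rewrite rst1. Qed.

Lemma rstwM g h w : rstw (g * h) w = rstw g (act A h w) * rstw h w.
Proof.
elim: w g h => [|x w IH] g h; first by rewrite act_nil.
by rewrite -[LHS]/(rstw (rst A (g * h) x) w) rstM IH (act_cons A h x w) rstw_cat.
Qed.

Definition zappa_szep (B : self_similar G X) : Type := (seq X * G)%type.

HB.instance Definition _ := Choice.copy (zappa_szep A) (seq X * G)%type.

Definition zs_mul (p q : zappa_szep A) : zappa_szep A :=
  (p.1 ++ act A p.2 q.1, rstw p.2 q.1 * q.2).

Definition zs_one : zappa_szep A := ([::], 1).

Lemma zs_mulA : associative zs_mul.
Proof.
move=> [u g] [v h] [w k]; rewrite /zs_mul /=; congr pair.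
  by rewrite act_cat actM catA.
by rewrite rstwM rstw_cat mulgA.
Qed.

Lemma zs_mul1 : left_id zs_one zs_mul.
Proof. by move=> [w g]; rewrite /zs_mul /= act1 rstw1 mul1g. Qed.

Lemma zs_mulr1 : right_id zs_one zs_mul.
Proof. by move=> [w g]; rewrite /zs_mul /= act_nil cats0 mulg1. Qed.

HB.instance Definition _ := isMonoid.Build (zappa_szep A) zs_mulA zs_mul1 zs_mulr1.

Definition zs_scale (p : zappa_szep A) : nat := (#|X| ^ size p.1)%N.

End SelfSimilar.

(* Main.v *)
Require Import Defs.
From HB Require Import structures.
From mathcomp Require Import all_boot all_order all_algebra.
From mathcomp Require Import all_classical all_reals all_analysis.

(** In [S = X^* |><| G] an element [g] acts bijectively on words, so the right
    ideal of [(v, g)] consists of all pairs whose word begins with [v]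
    ([zs_ridealE]). The order structure of [S] is therefore that of the rooted
    tree [X^*], and the group component is invisible to it: two ideals meet
    exactly when one word is a prefix of the other, and the longer word then
    generates the intersection.

    Since [X] has at least two letters, only the empty word is comparable with
    every word. Hence [S_c = {empty word} * G] is the group of units, [S_ci] is
    everything else, and [~] is equality of words: [S/~] is [X^*], and under
    this identification [alpha] is the given action of [G]. This settles (ii),
    and it reduces admissibility to facts about the tree: there are [|X|^k]
    words of length [k], distinct ones are incomparable, and every word is
    comparable with one of them. The range of the scale is the set of powers
    of [|X|], which is free on the single irreducible [|X|], and the zeta
    function is a geometric series of ratio [|X|^(1 - beta)], finite exactly
    for [beta > 1].

    For (iii), a transversal of [S/~] picks one group element [h_w] for each
    word [w]. If [a = (empty word, g)] and [f = (w, h_w)], then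
      [a f = (g(w), g|_w h_w) = (g(w), h_g(w)) (empty word, k)]
    with [k = h_g(w)^-1 g|_w h_w], so [C_a] is a copy of the set in the
    criterion. The only further demand on the transversal is that it lie in
    [S_ci^1], that is [h] takes the value [1] at the empty word; because
    [g(w)] is empty only when [w] is, imposing this changes the set in at most
    one element. *)

Set Implicit Arguments.
Unset Strict Implicit.
Unset Printing Implicit Defensive.

Import Order.TTheory GRing.Theory Num.Theory.

Local Open Scope classical_set_scope.
Local Open Scope group_scope.

Local Notation transversal := Defs.transversal.

(** * Transversals in a right LCM monoid *)

Section Transversals.
Variable S : monoidType.
Implicit Types (A T : set S).

(** Minimality forbids two equivalent members: the second could be deleted,
    the first representing everything that it represented. *)
Lemma transversal_sim_eq A T : right_LCM S -> transversal A T ->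
  forall t t', T t -> T t' -> sim t t' -> t = t'.
Proof.
move=> lcm [[TA Tr] Tmin] t t' Tt Tt' tt'; apply: contrapT => ntt'.
have : T `\ t' = T.
  apply: Tmin; first by move=> u [].
  split=> [u [Tu _]|s As]; first exact: TA.
  have [u Tu su] := Tr s As; have [ut'|nut'] := pselect (u = t').
    exists t => //; apply: sim_trans lcm _ _ _ su _; rewrite ut'.
    exact: sim_sym.
  by exists u.
by move=> TT; move: Tt'; rewrite -TT => -[_]; exact.
Qed.

Lemma sim_eq_transversal A T : complete_reps A T ->
  (forall t t', T t -> T t' -> sim t t' -> t = t') -> transversal A T.
Proof.
move=> cT inj; split=> // T' T'T [_ T'r]; apply/seteqP; split=> // t Tt.
have [t' T't' tt'] := T'r t (cT.1 t Tt).
by rewrite (inj t t' Tt (T'T _ T't') tt').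
Qed.

Lemma cls_eqP (s t : S) : right_LCM S -> cls s = cls t <-> sim s t.
Proof.
move=> lcm; split=> [st|st].
  by rewrite -[sim s t]/(cls s t) st; exact: sim_refl.
apply/seteqP; split=> u; last exact: sim_trans.
exact/(sim_trans lcm)/sim_sym.
Qed.

End Transversals.

(** * Scales whose values are the powers of an integer *)

Section Powers.
Variables (R : realType) (q : nat).
Hypothesis q_gt1 : (1 < q)%N.

Let powers := range (expn q).

Lemma Irr_powers : Irr powers = [set q].
Proof.
have q0 : (0 < q)%N by exact: ltnW.
apply/seteqP; split=> [_ [[k _ <-] nk1 irr]|_ ->].
  case: k nk1 irr => [//|k] _ irr.
  have pq : powers q by exists 1%N.
  have pk : powers (q ^ k)%N by exists k.
  have [q1|qk1] := irr _ _ pq pk (expnS q k).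
    by move: q_gt1; rewrite q1.
  by rewrite /= expnS qk1 muln1.
split; first by exists 1%N.
  by move=> q1; move: q_gt1; rewrite q1.
move=> _ _ [i _ <-] [j _ <-]; rewrite -expnD -{1}(expn1 q) => /eqP.
rewrite eqn_exp2l// => /eqP.
by case: i => [|i]; [left|case: j => [|j]; [right|rewrite addnS]].
Qed.

(** A product of irreducibles can only be a power of [q], and the exponent,
    which is the number of factors, is determined by the value. *)
Lemma free_on_Irr_powers : free_on_Irr powers.
Proof.
rewrite /free_on_Irr Irr_powers.
have nseqE (e : seq nat) : {in e, forall p, [set q] p} -> e = nseq (size e) q.
  by move=> eq; apply/all_pred1P/allP => p /eq /= ->.
have prodE n : (\prod_(p <- nseq n q) p = q ^ n)%N.
  by rewrite big_nseq iter_muln_1.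
split=> [_ [k _ <-]|e e' /nseqE -> /nseqE ->].
  by exists (nseq k q); rewrite ?prodE// => p /nseqP[].
by rewrite !prodE => /eqP; rewrite eqn_exp2l// => /eqP ->.
Qed.

Lemma zeta_powers (S : monoidType) (N : S -> nat) (beta : R) :
  range N = powers ->
  zeta N beta = \big[+%E/0%E]_(0 <= k <oo)
                  ((q%:R `^ (- (beta - 1)) : R) ^+ k)%:E%R.
Proof.
move=> rN; rewrite /zeta rN esum_image; last first.
  by move=> i j _ _ /eqP; rewrite eqn_exp2l// => /eqP.
rewrite nneseries_esumT; last first.
  by move=> k; rewrite lee_fin exprn_ge0// powR_ge0.
apply: eq_esum => k _; congr EFin.
by rewrite natrX -powR_mulrn// -powRrM -powR_mulrn ?powR_ge0// -powRrM mulrC.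
Qed.

(** For [beta > 1] the ratio [q^(1 - beta)] of the geometric series is below
    [1]; at [beta = 1] every term is [1], so no bound below [1] is possible. *)
Lemma critical_inverse_temperature_powers (S : monoidType) (N : S -> nat) :
  range N = powers -> critical_inverse_temperature N (1%R%:E : \bar R).
Proof.
move=> rN; split=> // [beta|b' b'Ny fin].
  rewrite lte_fin => beta_gt1; rewrite (zeta_powers _ rN).
  set z : R := powR _ _.
  have z_gt0 : (0 < z)%R by rewrite powR_gt0// ltr0n ltnW.
  have z_ge0 := ltW z_gt0.
  have z_lt1 : (`|z| < 1)%R.
    rewrite ger0_norm// /z powRN invf_lt1 ?powR_gt0 ?ltr0n ?(ltnW q_gt1)//.
    rewrite -[ltLHS](congr1 (fun f => f (beta - 1)%R) (powR1 R)).
    by rewrite gt0_ltr_powR ?subr_gt0 ?ltr1n// nnegrE.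
  apply: (@le_lt_trans _ _ (1 / (1 - z))%:E%R); last exact: ltry.
  apply: lime_le.
    by apply: is_cvg_nneseries => k _ _; rewrite lee_fin exprn_ge0.
  apply: nearW => n; rewrite sumEFin lee_fin.
  by have := geometric_le_lim n ler01 z_gt0 z_lt1; rewrite -exprn_geometric.
(* A smaller bound would make the series at beta = 1 finite. *)
rewrite leNgt; apply/negP => b'1.
have := fin 1%R b'1; rewrite (zeta_powers _ rN) subrr oppr0 powRr0.
set s := limn _ => s_fin.
have s_ge n : (n%:R%:E <= s)%E.
  apply: (le_trans _ (nneseries_lim_ge n _)); last first.
    by move=> k _ _; rewrite lee_fin expr1n.
  under eq_bigr do rewrite expr1n.
  by rewrite sumEFin big_mkord sumr_const card_ord.
have s_ge0 : (0 <= s)%E := s_ge 0%N.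
have s_num : s \is a fin_num by rewrite ge0_fin_numE.
have := s_ge (Num.truncn (fine s)).+1.
rewrite -(fineK s_num) lee_fin leNgt.
by have /andP[_ ->] := truncn_itv (fine_ge0 s_ge0).
Qed.

End Powers.

(** * Right ideals of the Zappa-Szep product *)

Section ZappaSzep.
Variables (G : groupType) (X : finType) (A : self_similar G X).
Local Notation S := (zappa_szep A).
Implicit Types (p q r s t : S) (g : G) (v w : seq X) (h : seq X -> G).

Lemma act_invK g : cancel (act A g) (act A g^-1).
Proof. by move=> w; rewrite -actM mulVg act1. Qed.

Lemma act_invVK g : cancel (act A g^-1) (act A g).
Proof. by move=> w; rewrite -actM mulgV act1. Qed.

Lemma zs_mulE p q : p * q = (p.1 ++ act A p.2 q.1, rstw A p.2 q.1 * q.2) :> S.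
Proof. by []. Qed.

(** The group component can be solved for, and [p.2] permutes [X^*], so that
    every continuation of [p.1] is reached. *)
Lemma zs_ridealE p : rideal p = [set q : S | prefix p.1 q.1].
Proof.
apply/seteqP; split=> [_ [x _ <-]|[w k] /= /prefixP[u ->]].
  exact: prefix_prefix.
exists (act A p.2^-1 u, (rstw A p.2 (act A p.2^-1 u))^-1 * k) => //.
by rewrite zs_mulE /= act_invVK mulVKg.
Qed.

Lemma prefix_comparable v w u :
  prefix v u -> prefix w u -> prefix v w \/ prefix w v.
Proof.
move=> /prefixP[a ->] /prefixP[b]; elim: v w => [|x v IH] [|y w]; auto.
by move=> /= [-> /IH[]]; rewrite !eqxx /=; auto.
Qed.

Lemma zs_rideal_meetP p q :
  rideal p `&` rideal q !=set0 <-> prefix p.1 q.1 \/ prefix q.1 p.1.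
Proof.
rewrite !zs_ridealE; split=> [[s [/= ps qs]]|[pq|qp]].
- exact: prefix_comparable ps qs.
- by exists q; split=> //=; exact: prefix_refl.
- by exists p; split=> //=; exact: prefix_refl.
Qed.

Lemma zs_left_cancellative : left_cancellative S.
Proof.
move=> [v g] [w h] [w' h']; rewrite !zs_mulE => -[/= /eqP].
rewrite eqseq_cat// eqxx /= => /eqP/(can_inj (act_invK g)) <-.
by move/mulgI => <-.
Qed.

Lemma zs_right_LCM : right_LCM S.
Proof.
split=> [|p q]; first exact: zs_left_cancellative.
have [->|/set0P/zs_rideal_meetP pq] := eqVneq (rideal p `&` rideal q) set0.
  by left.
right; rewrite /is_right_lcm !zs_ridealE; case: pq => [pq|qp].
  exists q; rewrite zs_ridealE; apply: setIidr => s /=; exact: prefix_trans.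
exists p; rewrite zs_ridealE; apply: setIidl => s /=; exact: prefix_trans.
Qed.

(** * The core, its complement and the relation [~] *)

Hypothesis card_X : (1 < #|X|)%N.

(** A word beginning with [x] is incomparable with the one-letter word on any
    other letter; this is where two letters are needed. *)
Lemma zs_ScE p : Sc p <-> p.1 = [::].
Proof.
split=> [cp|p0 s]; last by apply/zs_rideal_meetP; left; rewrite p0 prefix0s.
case: p cp => -[//|x v] g cp.
have /card_gt1P[y [z [_ _ yz]]] := card_X.
have xE u : x = u.
  by have /zs_rideal_meetP[] := cp ([:: u], 1) => /= /andP[/eqP].
by rewrite -(xE y) -(xE z) eqxx in yz.
Qed.

Lemma zs_invertible p : p.1 = [::] -> invertible p.
Proof.
case: p => _ g /= ->; exists ([::], g^-1).
by rewrite !zs_mulE /= !act_nil mulgV mulVg.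
Qed.

(** The factorisation condition in [S_ci] is automatic, the core being the
    group of units. *)
Lemma zs_SciE p : Sci p <-> p.1 <> [::].
Proof.
split=> [[ncp _] p0|np0]; first exact/ncp/zs_ScE.
split=> [/zs_ScE//|t a /zs_ScE a0 _]; exact: zs_invertible.
Qed.

Lemma zs_simE p q : sim p q <-> p.1 = q.1.
Proof.
split=> [[a [b [/zs_ScE a0 /zs_ScE b0]]]|pq].
  by rewrite !zs_mulE a0 b0 !act_nil !cats0 => -[].
exists ([::], p.2^-1), ([::], q.2^-1); split; try exact/zs_ScE.
by rewrite !zs_mulE /= !act_nil pq !mulgV.
Qed.

Lemma zs_cls_eqP p q : cls p = cls q <-> p.1 = q.1.
Proof. by rewrite (cls_eqP _ _ zs_right_LCM); exact: zs_simE. Qed.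

Lemma zs_A1 : A1 S.
Proof.
move=> [[|x w] g].
  exists 1, ([::], g); split; [by right|exact/zs_ScE|by rewrite mul1g].
exists (x :: w, g), 1; split; [|exact: Sc1|by rewrite mulg1].
by left; apply/zs_SciE.
Qed.

(** A right LCM of [s] and [t] has [s.1] as a prefix of its word. *)
Lemma zs_A2 : A2 S.
Proof.
move=> s t r /zs_SciE s0 _ lcm; apply/zs_SciE => r0; apply: s0.
have : rideal r r by rewrite zs_ridealE /= prefix_refl.
by rewrite -lcm => -[]; rewrite zs_ridealE /= r0 prefixs0 => /eqP.
Qed.

(** * Admissibility *)

Local Notation N := (zs_scale (A := A) : S -> nat).

Lemma zs_scale_eqP p k : N p = (#|X| ^ k)%N <-> size p.1 = k.
Proof.
by split=> [/eqP|<-//]; rewrite /zs_scale eqn_exp2l// => /eqP.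
Qed.

Lemma range_zs_scale : range N = range (expn #|X|).
Proof.
apply/seteqP; split=> [_ [p _ <-]|_ [k _ <-]]; first by exists (size p.1).
have /card_gt0P[x _] := ltnW card_X.
by exists (nseq k x, 1) => //; apply/zs_scale_eqP; rewrite size_nseq.
Qed.

Lemma zs_nontrivial_hom : nontrivial_hom N.
Proof.
split=> [s| |s t|]; rewrite ?/zs_scale ?expn0//.
- by rewrite expn_gt0 ltnW.
- by rewrite zs_mulE /= size_cat size_act expnD.
have /card_gt0P[x _] := ltnW card_X.
by exists ([:: x], 1); rewrite expn1 => X1; move: card_X; rewrite X1.
Qed.

Lemma card_zs_quot_scale n : range N n ->
  (quot (N @^-1` [set n]) #= `I_n)%card.
Proof.
rewrite range_zs_scale => -[k _ <-].
pose f (u : k.-tuple X) : set S := cls ((val u, 1) : S).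
have -> : quot (N @^-1` [set (#|X| ^ k)%N]) = range f.
  apply/seteqP; split=> [_ [p /zs_scale_eqP pk <-]|_ [u _ <-]].
    have pk' : size p.1 == k by apply/eqP.
    by exists (Tuple pk') => //; apply/zs_cls_eqP.
  exists (val u, 1) => //; apply/zs_scale_eqP; exact: size_tuple.
have finj : {in [set: k.-tuple X] &, injective f}.
  by move=> u v _ _ /zs_cls_eqP /= uv; apply: val_inj.
apply: card_eq_trans (inj_card_eq finj) _.
rewrite -card_tuple; apply: card_eq_trans (card_esym card_II).
rewrite card_eq_sym -(_ : range (@enum_rank (k.-tuple X)) = setT); last first.
  by apply/seteqP; split=> // i _; exists (enum_val i); rewrite ?enum_valK.
by apply: inj_card_eq => u v _ _; exact: enum_rank_inj.
Qed.

(** Such a transversal contains exactly one element over each word of length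
    [k]. Two of these words are comparable only if equal, and any word becomes
    comparable with its own length-[k] prefix once it is padded to length at
    least [k]. *)
Lemma zs_transversal_foundation k T :
  transversal (N @^-1` [set (#|X| ^ k)%N]) T -> foundation_set T /\ accurate T.
Proof.
move=> trT; have [[TN Tr] _] := trT.
have Tsz p : T p -> size p.1 = k by move=> /TN/zs_scale_eqP.
have Tinj p q : T p -> T q -> p.1 = q.1 -> p = q.
  move=> Tp Tq /zs_simE; exact: transversal_sim_eq zs_right_LCM trT _ _ _ _.
split; last first.
  move=> p q Tp Tq npq; apply: contrapT => /eqP/set0P/zs_rideal_meetP pq.
  apply: npq; apply: Tinj => //.
  by case: pq => /prefixP[u e]; have := congr1 size e;
     rewrite size_cat !Tsz// => /eqP; rewrite -[X in X == _]addn0 eqn_add2l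
     => /eqP/esym/size0nil u0; rewrite e u0 cats0.
split.
  have fstT : {in T &, injective (fun p : S => p.1)}.
    by move=> p q /set_mem Tp /set_mem Tq; exact: Tinj.
  rewrite -(eq_finite_set (inj_card_eq fstT)).
  apply: (@sub_finite_set _ _ (range (fun u : k.-tuple X => val u))).
    by move=> _ [p /Tsz/eqP pk <-]; exists (Tuple pk).
  exact: finite_image.
move=> s; have /card_gt0P[x _] := ltnW card_X.
pose w := take k (s.1 ++ nseq k x).
have szw : size w = k.
  by rewrite size_takel// size_cat size_nseq leq_addl.
have [f Tf /zs_simE /= wf] := Tr (w, 1) (proj2 (zs_scale_eqP (w, 1) k) szw).
exists f => //; apply/zs_rideal_meetP; rewrite -wf.
apply: (@prefix_comparable _ _ (s.1 ++ nseq k x)); first exact: prefix_prefix.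
by apply/prefixP; exists (drop k (s.1 ++ nseq k x)); rewrite cat_take_drop.
Qed.

Lemma zs_generalised_scale : generalised_scale N.
Proof.
split; [exact: zs_nontrivial_hom|exact: card_zs_quot_scale|].
move=> n; rewrite range_zs_scale => -[k _ <-] T.
exact: zs_transversal_foundation.
Qed.

Lemma zs_admissible : admissible_with N.
Proof.
split; [exact: zs_right_LCM|exact: zs_A1|exact: zs_A2
       |exact: zs_generalised_scale|].
by rewrite range_zs_scale; exact: free_on_Irr_powers.
Qed.

(** * The action of the core on the classes *)

Lemma zs_alphaE g p : alpha (([::], g) : S) (cls p) = cls ((act A g p.1, 1) : S).
Proof. by rewrite (alpha_cls zs_right_LCM); apply/zs_cls_eqP. Qed.

Lemma zs_alpha_eqP g k p :
  alpha (([::], g) : S) (cls p) = alpha (([::], k) : S) (cls p) <->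
  act A g p.1 = act A k p.1.
Proof. by rewrite !zs_alphaE; exact: zs_cls_eqP. Qed.

Lemma zs_faithful : faithful_action (@Sc S) (quot [set: S]) (@alpha S) <->
  faithful_action [set: G] [set: seq X] (act A).
Proof.
split=> [fa g h _ _ gh|fa p q].
  have [||[]|_ [p _ <-] ne] := fa ([::], g) ([::], h); try exact/zs_ScE.
    exact: gh.
  by exists p.1 => // e; apply: ne; exact/zs_alpha_eqP.
case: p q => v g [w h] /zs_ScE /= -> /zs_ScE /= -> npq.
have [//|//|e|u _ ne] := fa g h; first by apply: npq; rewrite e.
by exists (cls ((u, 1) : S)) => [|/zs_alpha_eqP//]; exists (u, 1).
Qed.

Lemma zs_almost_free : almost_free_action (@Sc S) (quot [set: S]) (@alpha S) <->
  almost_free_action [set: G] [set: seq X] (act A).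
Proof.
pose c (w : seq X) : set S := cls ((w, 1) : S).
have cinj : injective c by move=> v w /zs_cls_eqP.
have fixE g k : [set Y | quot [set: S] Y /\
      alpha (([::], g) : S) Y = alpha (([::], k) : S) Y] =
    c @` [set w | [set: seq X] w /\ act A g w = act A k w].
  apply/seteqP; split=> [_ [[p _ <-] /zs_alpha_eqP e]|_ [w [_ e] <-]].
    by exists p.1 => //; apply/zs_cls_eqP.
  by split; [exists (w, 1)|apply/zs_alpha_eqP].
split=> [fa g h _ _ gh|fa p q].
  have := fa ([::], g) ([::], h) (proj2 (zs_ScE ([::], _)) erefl)
    (proj2 (zs_ScE ([::], _)) erefl) (fun e => gh (congr1 snd e)).
  by rewrite fixE (eq_finite_set (inj_card_eq (in2W cinj))).
case: p q => v g [w h] /zs_ScE /= -> /zs_ScE /= -> npq.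
rewrite fixE; apply: finite_image; apply: fa => // e; apply: npq.
by rewrite e.
Qed.

(** * Finite propagation *)

Definition twisted_restrictions (h : seq X -> G) g : set G :=
  [set (h (act A g w))^-1 * rstw A g w * h w | w in [set: seq X]].

Definition word_section (h : seq X -> G) : set S := range (fun w => (w, h w) : S).

(** Comparing [(empty word, g) (w, h w) = (g(w), g|_w h w)] with
    [(v, h v) (empty word, k)] forces [v = g(w)] and
    [k = h_g(w)^-1 g|_w h_w]. *)
Lemma C_set_word_section h g :
  C_set (word_section h) (([::], g) : S) =
  (fun k => ([::], k) : S) @` twisted_restrictions h g.
Proof.
apply/seteqP; split=> [[u k] [/zs_ScE /= u0 [_ [_ [[w _ <-] [v _ <-]]]]]|].
  rewrite !zs_mulE /= u0 act_nil cats0 => -[<- e].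
  exists ((h (act A g w))^-1 * rstw A g w * h w); first by exists w.
  by rewrite -mulgA e mulKg.
move=> _ [_ [w _ <-] <-]; split; first exact/zs_ScE.
exists (w, h w), (act A g w, h (act A g w)); split; [by exists w|by exists (act A g w)|].
by rewrite !zs_mulE /= act_nil cats0 -!mulgA mulVKg.
Qed.

Lemma finite_C_set_word_section h g :
  finite_set (C_set (word_section h) (([::], g) : S)) <->
  finite_set (twisted_restrictions h g).
Proof.
rewrite C_set_word_section (eq_finite_set (inj_card_eq _))//.
by move=> k l _ _ [].
Qed.

Lemma transversal_word_section h : transversal [set: S] (word_section h).
Proof.
apply: sim_eq_transversal; last first.
  by move=> _ _ [v _ <-] [w _ <-] /zs_simE /= ->.
split=> // s _; exists (s.1, h s.1); first by exists s.1.
exact/zs_simE.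
Qed.

(** The transversals of [S/~] are exactly the graphs of functions [X^* -> G]:
    a class consists of all pairs over one word. *)
Lemma word_section_of_transversal T : transversal [set: S] T ->
  exists h, T = word_section h.
Proof.
move=> trT; have [[_ Tr] _] := trT.
have Tw (w : seq X) : {k : G | T (w, k)}.
  apply: cid; have [[v k] Tvk /zs_simE /= e] := Tr (w, 1) Logic.I.
  by exists k; rewrite e.
exists (fun w => sval (Tw w)); apply/seteqP; split=> [[w k] Twk|_ [w _ <-]].
  exists w => //; apply: (transversal_sim_eq zs_right_LCM trT) => //.
    exact: (svalP (Tw w)).
  exact/zs_simE.
exact: (svalP (Tw w)).
Qed.

Lemma word_section_Sci1 h : h [::] = 1 -> word_section h `<=` @Sci1 S.
Proof.
move=> h1 _ [[|x w] _ <-]; first by right; rewrite h1.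
by left; apply/zs_SciE.
Qed.

(** As [g] preserves length, [h [::]] enters only through [w = [::]], so
    resetting it to [1] affects a single element of the set, which becomes
    [g]. *)
Lemma finite_twisted_normalise h g : finite_set (twisted_restrictions h g) ->
  finite_set (twisted_restrictions (fun w => if w is [::] then 1 else h w) g).
Proof.
move=> fin; apply: (@sub_finite_set _ _ (g |` twisted_restrictions h g)).
  move=> _ [[|x w] _ <-] /=.
    by left; rewrite act_nil invg1 mul1g mulg1.
  right; exists (x :: w) => //.
  by case: (act A g (x :: w)) (size_act A g (x :: w)).
by rewrite finite_setU; split.
Qed.

Lemma zs_finite_propagation : finite_propagation S <->
  forall g1 g2 : G, exists h : seq X -> G,
    finite_set (twisted_restrictions h g1) /\
    finite_set (twisted_restrictions h g2).
Proof.
split=> [fp g1 g2|tw [u g1] [v g2] /zs_ScE /= -> /zs_ScE /= ->].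
  have [||T [trT _ fin1 fin2]] := fp ([::], g1) ([::], g2); try exact/zs_ScE.
  have [h Th] := word_section_of_transversal trT.
  by exists h; split; apply/finite_C_set_word_section; rewrite -Th.
have [h [fin1 fin2]] := tw g1 g2.
exists (word_section (fun w => if w is [::] then 1 else h w)).
split; [exact: transversal_word_section|exact: word_section_Sci1| |];
  exact/finite_C_set_word_section/finite_twisted_normalise.
Qed.

(** The constant family [h = 1] leaves just the restrictions of [g]. *)
Lemma finite_state_finite_propagation : finite_state A -> finite_propagation S.
Proof.
move=> fs; apply/zs_finite_propagation => g1 g2; exists (fun=> 1).
suff E g : twisted_restrictions (fun=> 1) g = range (rstw A g).
  by rewrite !E.
by apply: eq_imagel => w _; rewrite invg1 mul1g mulg1.
Qed.

End ZappaSzep.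

Theorem proposition5p8 (R : realType) (G : groupType) (X : finType)
    (A : self_similar G X)
    (countable_G : countable [set: G]) (card_X : (1 < #|X|)%N) :
  let S : monoidType := zappa_szep A in
  (* (i) *)
  (admissible_with (zs_scale (A := A) : S -> nat) /\
   critical_inverse_temperature (zs_scale (A := A) : S -> nat) (1%R%:E : \bar R)) /\
  (* (ii) *)
  ((faithful_action (@Sc S) (quot [set: S]) (@alpha S) <->
    faithful_action [set: G] [set: seq X] (act A)) /\
   (almost_free_action (@Sc S) (quot [set: S]) (@alpha S) <->
    almost_free_action [set: G] [set: seq X] (act A))) /\
  (* (iii) *)
  ((finite_propagation S <->
    forall g1 g2 : G, exists h : seq X -> G,
      finite_set [set (h (act A g1 w))^-1 * rstw A g1 w * h w | w in [set: seq X]] /\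
      finite_set [set (h (act A g2 w))^-1 * rstw A g2 w * h w | w in [set: seq X]]) /\
   (finite_state A -> finite_propagation S)).
Proof.
move=> S; split; first split.
- exact: zs_admissible.
- exact/(critical_inverse_temperature_powers _ card_X)/range_zs_scale.
split; first by split; [exact: zs_faithful|exact: zs_almost_free].
split; [exact: zs_finite_propagation|exact: finite_state_finite_propagation].
Qed.
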